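(* Let $G=(V,E)$ be a graph, $a_0\in V$ a vertex, and $k$ a positive integer. Let $G'$ denote $G$ with a path of length $k$ added at $a_0$, i.e. $G'=(V\cup\{a_1,\ldots,a_k\},\,E\cup\{a_0a_1,a_1a_2,\ldots,a_{k-1}a_k\})$ with $a_1,\ldots,a_k$ new vertices. Let $\mathbf{x}=(x_a)$ be a labeling of the vertices of $G'$ with variables. Then, as a polynomial identity, \[ I(G';\mathbf{x}) = C_k\, I(G;\mathbf{y}), \] where $y_v=x_v$ for all $v\in V\setminus\{a_0\}$, $y_{a_0}=B_k/C_k$, and $B_0=x_{a_k}$, $C_0=1$ and, for $0\le i<k$, \[ \begin{pmatrix} B_{i+1}\\ C_{i+1}\end{pmatrix} = \begin{pmatrix} 0 & x_{a_{k-i-1}}\\ 1 & 1\end{pmatrix}\begin{pmatrix} B_i\\ C_i\end{pmatrix}. \] Moreover, let $x\in\mathbb{R}$ with $x>-\tfrac14$ and $x\neq 0$, let $\lambda_1,\lambda_2=\tfrac12\pm\sqrt{\tfrac14+x}$ be the two roots of $\lambda^2-\lambda-x$, set $x_a=x$ for all $a\in\{a_0,\ldots,a_k\}$, and assume $\lambda_1^{k+2}\neq\lambda_2^{k+2}$. Then the identity $I(G';\mathbf{x})=C_k\,I(G;\mathbf{y})$ (with $y_{a_0}=B_k/C_k$ and $y_v=x_v$ otherwise) holds with \[ B_k=\frac{x}{\lambda_2-\lambda_1}\big(\lambda_2^{k+1}-\lambda_1^{k+1}\big),\qquad C_k=\frac{1}{\lambda_2-\lambda_1}\big(\lambda_2^{k+2}-\lambda_1^{k+2}\big).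 \]
   Context: For a graph $G=(V,E)$ and a vertex-indexed family of variables $\mathbf{x}=(x_a)_{a\in V}$, the multivariate independent set polynomial is $I(G;\mathbf{x})=\sum_{A\subseteq V,\ A\text{ independent}}\prod_{a\in A}x_a$. The single-variable version $I(G;x)$ is obtained by setting every $x_a=x$. *)

(* Defs.v *)
From mathcomp Require Import all_boot all_order all_algebra reals.
From mathcomp Require Import mpoly.

Set Implicit Arguments.
Unset Strict Implicit.
Unset Printing Implicit Defensive.

Import GRing.Theory.
Local Open Scope ring_scope.

Section IndependentSetPolynomial.
Variables (T : finType) (e : rel T).

Definition independent (A : {set T}) : bool :=
  [forall u in A, forall v in A, ~~ e u v].

Definition indep_poly (R : comNzRingType) (x : T -> R) : R :=
  \sum_(A : {set T} | independent A) \prod_(a in A) x a.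

End IndependentSetPolynomial.

Section PathExtension.
Variables (T : finType) (e : rel T) (a0 : T) (k : nat).

(* The vertex a_j of the added path, meaningful for j <= k: the base vertex
   a_0 lies in T, and the new vertex a_j.+1 is inr j. *)
Definition path_vertex (j : nat) : T + 'I_k :=
  if j is j'.+1 then oapp inr (inl a0) (insub j') else inl a0.

Definition on_path (w : T + 'I_k) : bool :=
  [exists j : 'I_k.+1, w == path_vertex j].

Definition old_edge (u v : T + 'I_k) : bool :=
  match u, v with inl u', inl v' => e u' v' | _, _ => false end.

Definition path_edge (u v : T + 'I_k) : bool :=
  [exists j : 'I_k,
     (u == path_vertex j) && (v == path_vertex j.+1)
  || (v == path_vertex j) && (u == path_vertex j.+1)].

Definition add_path : rel (T + 'I_k)%type :=
  fun u v => old_edge u v || path_edge u v.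

Lemma path_vertexS (j : 'I_k) : path_vertex j.+1 = inr j.
Proof. by rewrite /path_vertex valK. Qed.

Lemma add_path_sym : ssrbool.symmetric e -> ssrbool.symmetric add_path.
Proof.
move=> se u v; rewrite /add_path; congr orb.
  by case: u v => [u|i] [v|j] //=.
by apply: eq_existsb => j; rewrite orbC.
Qed.

Lemma add_path_irr : irreflexive e -> irreflexive add_path.
Proof.
move=> ie u; apply/negbTE; rewrite negb_or; apply/andP; split.
  by case: u => //= u; rewrite ie.
apply/existsPn => j; rewrite orbb path_vertexS; apply/negP => /andP[/eqP->].
case: j => -[|m] ltmk /=; first by [].
rewrite insubT ?(ltnW ltmk) // => ltm /eqP[] /eqP.
by rewrite ltn_eqF.
Qed.

End PathExtension.

Arguments path_vertex {T} a0 k j : assert.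
Arguments add_path {T} e a0 k _ _ : assert.

(* (B_i, C_i) for the labels z j = x_(a_j) of the path; the successor case is
   the product of the matrix [0, z (k-i-1); 1, 1] with the column (B_i, C_i). *)
Fixpoint BC (R : comNzRingType) (k : nat) (z : nat -> R) (i : nat) : R * R :=
  if i is i'.+1 then
    let: (b, c) := BC k z i' in (0 * b + z (k - i' - 1)%N * c, 1 * b + 1 * c)
  else (z k, 1).

Definition B_ (R : comNzRingType) (k : nat) (z : nat -> R) (i : nat) : R :=
  (BC k z i).1.
Definition C_ (R : comNzRingType) (k : nat) (z : nat -> R) (i : nat) : R :=
  (BC k z i).2.

(* Main.v *)
(** Deleting a vertex [v] splits the independent sets of an induced subgraph
    [U] into those avoiding [v] and those containing [v]:
    [I(U) = I(U - v) + x_v I(U - N[v])].  Let [U_j] consist of the old vertices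
    together with [a_1, ..., a_j].  Deletion at [a_(j-1)] shows that
    [C I(U_j - a_j) + B I(U_j - N[a_j])] is unchanged when [j] decreases by one
    and [(B, C)] is replaced by [(x_(a_(j-1)) C, B + C)], because [U_j - a_j]
    is [U_(j-1)] and [U_j - N[a_j]] is [U_(j-1) - a_(j-1)].  At [j = k] with
    [(B, C) = (x_(a_k), 1)] the expression is [I(G'; x)]; at [j = 0] it is
    [C_k I(G; y)] by deletion at [a_0].  No division is needed until then. *)

Require Import Defs.
From mathcomp Require Import all_boot all_order all_algebra reals.
From mathcomp Require Import mpoly.
From mathcomp Require Import ring lra.
Local Open Scope ring_scope.

Import Order.TTheory GRing.Theory Num.Theory.
Set Implicit Arguments.
Unset Strict Implicit.
Unset Printing Implicit Defensive.

(** * Independent sets of induced subgraphs and vertex deletion *)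

Section InducedSubgraph.
Variables (T : finType) (e : rel T) (R : comNzRingType).
Implicit Types (x y : T -> R) (U A : {set T}).

(** An induced subgraph is kept as a subset of the same vertex type, so deletions can be iterated
    without changing the graph. *)
Definition indep_poly_in x U : R :=
  \sum_(A : {set T} | independent e A && (A \subset U)) \prod_(a in A) x a.

Lemma indep_poly_inT x : indep_poly e x = indep_poly_in x setT.
Proof. by apply: eq_bigl => A; rewrite subsetT andbT. Qed.

Lemma eq_indep_poly_in x y U :
  {in U, x =1 y} -> indep_poly_in x U = indep_poly_in y U.
Proof.
move=> xy; apply: eq_bigr => A /andP[_ /subsetP AU].
by apply: eq_bigr => a /AU /xy.
Qed.

Definition neighbors (v : T) : {set T} := [set u | e v u].

Lemma independentP A :
  reflect {in A &, forall u v, ~~ e u v} (independent e A).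
Proof.
apply: (iffP forall_inP) => [h u v uA vA | h u uA].
  by move/forall_inP: (h u uA); apply.
by apply/forall_inP => v vA; apply: h.
Qed.

Hypotheses (e_sym : ssrbool.symmetric e) (e_irr : irreflexive e).

Lemma independentU1 v A :
  independent e (v |: A) = independent e A && [disjoint A & neighbors v].
Proof.
apply/independentP/andP => [h | [/independentP hA dA] a b].
  split.
    by apply/independentP => a b aA bA; apply: h; rewrite !inE ?aA ?bA orbT.
  apply/pred0P => a /=; apply/negP => /andP[aA]; rewrite inE; apply/negP.
  by apply: h; rewrite !inE ?eqxx ?aA ?orbT.
have hv c : c \in A -> ~~ e v c.
  by move=> /(disjointFr dA); rewrite inE => ->.
rewrite !inE => /predU1P[->|aA] /predU1P[->|bA]; rewrite ?e_irr //.
- exact: hv.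
- by rewrite e_sym hv.
- exact: hA.
Qed.

Lemma indep_poly_in_del x U v : v \in U ->
  indep_poly_in x U = indep_poly_in x (U :\ v)
    + x v * indep_poly_in x ((U :\ v) :\: neighbors v).
Proof.
move=> vU; rewrite /indep_poly_in (bigID [pred A : {set T} | v \in A]) /= addrC.
congr (_ + _).
  by apply: eq_bigl => A; rewrite subsetD1 -andbA.
(* The independent sets containing [v] are the sets [v |: A] where [A] is independent and avoids
   both [v] and its neighbors. *)
rewrite (reindex_onto (fun A => v |: A) (fun A => A :\ v)) /=; last first.
  by move=> A /andP[_ vA]; rewrite setD1K.
rewrite big_distrr /=; apply: eq_big => [A | A /andP[_ /eqP AE]].
  rewrite setU11 andbT independentU1 subUset sub1set vU /=.
  have -> : ((v |: A) :\ v == A) = (v \notin A).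
    apply/eqP/idP => [<-|]; first by rewrite setD11.
    exact: setU1K.
  rewrite subsetD subsetD1 -!andbA; congr (_ && _).
  by rewrite andbC -andbA.
by rewrite big_setU1 // -AE setD11.
Qed.

End InducedSubgraph.

(** * Transport along graph embeddings and ring morphisms *)

Lemma indep_poly_in_imset (T T' : finType) (e : rel T) (e' : rel T')
    (R : comNzRingType) (f : T -> T') (x : T' -> R) (U : {set T}) :
  injective f -> (forall u v, e' (f u) (f v) = e u v) ->
  indep_poly_in e' x (f @: U) = indep_poly_in e (x \o f) U.
Proof.
move=> f_inj f_e; rewrite /indep_poly_in.
have preK (A : {set T}) : f @^-1: (f @: A) = A.
  by apply/setP => u; rewrite inE mem_imset.
rewrite (reindex_onto (fun A : {set T} => f @: A) (fun A => f @^-1: A)) /=.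
  apply: eq_big => [A | A _]; last by rewrite big_imset //= => u v _ _ /f_inj.
  rewrite preK eqxx andbT; congr (_ && _).
    apply/independentP/independentP => [h u v uA vA | h u' v'].
      by rewrite -f_e h ?imset_f.
    by move=> /imsetP[u uA ->] /imsetP[v vA ->]; rewrite f_e h.
  apply/idP/idP => [|/imsetS]; last by [].
  by move/(preimsetS f); rewrite !preK.
move=> A /andP[_ /subsetP AU]; apply/setP => w; apply/imsetP/idP => [[u]|wA].
  by rewrite inE => uA ->.
by have /imsetP[u _ wE] := AU w wA; exists u; rewrite // inE -wE.
Qed.

Lemma rmorph_indep_poly_in (T : finType) (e : rel T) (R S : comNzRingType)
    (f : {rmorphism R -> S}) (x : T -> R) (U : {set T}) :
  f (indep_poly_in e x U) = indep_poly_in e (f \o x) U.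
Proof. by rewrite rmorph_sum; apply: eq_bigr => A _; rewrite rmorph_prod. Qed.

(** * Removing the added path vertex by vertex *)

Section AddPath.
Variables (T : finType) (e : rel T) (a0 : T) (k : nat).
Hypotheses (e_sym : ssrbool.symmetric e) (e_irr : irreflexive e).

(** This is the set $U_j$: as [inr i] is $a_{i+1}$, the test [i < j] keeps exactly
    $a_1,\ldots,a_j$. *)
Definition truncation (j : nat) : {set T + 'I_k} :=
  [set w : T + 'I_k | if w is inr i then (i < j)%N else true].

Lemma truncation_full : truncation k = setT.
Proof. by apply/setP => -[u|i]; rewrite !inE ?ltn_ord. Qed.

Lemma truncation0 : truncation 0 = inl @: [set: T].
Proof.
apply/setP => -[u|i]; rewrite inE; first by rewrite imset_f.
by apply/esym/imsetP => -[].
Qed.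

Lemma truncationS (j : 'I_k) : truncation j.+1 :\ inr j = truncation j.
Proof.
apply/setP => -[u|i]; rewrite !inE //=.
by rewrite (inj_eq (fun _ _ => @inr_inj _ _ _ _)) ltnS [RHS]ltn_neqAle.
Qed.

Lemma path_vertex_truncation j :
  (j <= k)%N -> path_vertex a0 k j \in truncation j.
Proof.
case: j => [|j] ltjk; first by rewrite inE.
by rewrite -[j]/(val (Ordinal ltjk)) path_vertexS inE.
Qed.

(** The vertex [inr j] is $a_{j+1}$; its only other possible neighbor, $a_{j+2}$, lies outside
    $U_j$. *)
Lemma add_path_inr (j : 'I_k) w : w \in truncation j ->
  add_path e a0 k (inr j) w = (w == path_vertex a0 k j).
Proof.
move=> wj; rewrite /add_path /=; apply/existsP/eqP => [[i] | ->]; last first.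
  by exists j; rewrite path_vertexS !eqxx orbT.
rewrite !path_vertexS => /orP[/andP[/eqP jE /eqP wE] | /andP[/eqP-> /eqP[->]] //].
(* If instead [inr j] were the earlier end of the edge, then [j < i], while [w = inr i] in $U_j$
   gives [i < j]. *)
have := path_vertex_truncation (ltnW (ltn_ord i)).
by rewrite -jE; move: wj; rewrite wE !inE => /ltnW; rewrite leqNgt => /negP.
Qed.

Lemma truncationS_neighbors (j : 'I_k) :
  (truncation j.+1 :\ inr j) :\: neighbors (add_path e a0 k) (inr j)
  = truncation j :\ path_vertex a0 k j.
Proof.
rewrite truncationS; apply/setP => w; rewrite in_setD in_setD1 [w \in neighbors _ _]inE.
by case: (boolP (w \in truncation j)) => [/add_path_inr ->|]; rewrite ?andbF.
Qed.

Variables (R : comNzRingType) (x : T + 'I_k -> R).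
Let G' := add_path e a0 k.
Let B := B_ k (fun j => x (path_vertex a0 k j)).
Let C := C_ k (fun j => x (path_vertex a0 k j)).

Lemma B_S i : B i.+1 = x (path_vertex a0 k (k - i - 1)) * C i.
Proof. by rewrite /B /C /B_ /C_ /=; case: BC => b c /=; rewrite mul0r add0r. Qed.

Lemma C_S i : C i.+1 = B i + C i.
Proof. by rewrite /B /C /B_ /C_ /=; case: BC => b c /=; rewrite !mul1r. Qed.

Lemma indep_poly_add_path_truncation i : (i <= k)%N ->
  let U := truncation (k - i) :\ path_vertex a0 k (k - i) in
  indep_poly G' x = C i * indep_poly_in G' x U
    + B i * indep_poly_in G' x (U :\: neighbors G' (path_vertex a0 k (k - i))).
Proof.
have G'_sym : ssrbool.symmetric G' by exact: add_path_sym.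
have G'_irr : irreflexive G' by exact: add_path_irr.
elim: i => [_ | i IHi ltik] /=.
  rewrite subn0 indep_poly_inT -truncation_full.
  by rewrite (indep_poly_in_del G'_sym G'_irr x (path_vertex_truncation (leqnn k))) mul1r.
have /= -> := IHi (ltnW ltik).
have ltjk : (k - i.+1 < k)%N by rewrite ltn_subrL (leq_ltn_trans _ ltik).
(* With $j = k-i-1$, the vertex $a_{k-i}$ is the new vertex [inr j], and the next deletion is at
   $a_j$. *)
have -> : (k - i = (Ordinal ltjk).+1)%N by rewrite /= -subSn.
rewrite path_vertexS truncationS_neighbors truncationS.
rewrite (indep_poly_in_del G'_sym G'_irr x (path_vertex_truncation (ltnW ltjk))) /=.
rewrite B_S C_S -subnDA addn1; ring.
Qed.

Lemma indep_poly_add_path :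
  indep_poly G' x = C k * indep_poly_in e (x \o inl) [set~ a0]
    + B k * indep_poly_in e (x \o inl) ([set~ a0] :\: neighbors e a0).
Proof.
have inl_inj : injective (@inl T 'I_k) by move=> u v [].
have G'_inl u v : G' (inl u) (inl v) = e u v.
  rewrite /G' /add_path /=; case: (e u v) => //=.
  by apply/existsP => -[j]; rewrite path_vertexS => /orP[] /andP[].
have /= -> := indep_poly_add_path_truncation (leqnn k).
(* Only old vertices remain, and [inl] embeds the original graph as an induced subgraph. *)
rewrite subnn truncation0 /= -!(indep_poly_in_imset x _ inl_inj G'_inl).
have mem_inl (U : {set T}) u : (@inl T 'I_k u \in inl @: U) = (u \in U).
  exact: mem_imset.
have mem_inr (U : {set T}) i : (@inr T 'I_k i \in inl @: U) = false.
  by apply/imsetP => -[].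
congr (_ * _ + _ * _); congr indep_poly_in.
  by apply/setP => -[u|i]; rewrite in_setD1 ?mem_inl ?mem_inr ?inE ?andbT ?andbF.
apply/setP => -[u|i]; rewrite in_setD in_setD1 ?mem_inl ?mem_inr ?andbF //.
by rewrite !inE andbT G'_inl.
Qed.

End AddPath.

(** Requiring $C_k y_{a_0} = B_k$ in the target of [f] replaces the quotient, so one statement
    covers both the fraction field and the case of scalar $B_k$, $C_k$. *)
Lemma indep_poly_add_path_div (T : finType) (e : rel T) (a0 : T) (k : nat)
    (R S : comNzRingType) (f : {rmorphism R -> S})
    (x : T + 'I_k -> R) (y : T -> S) :
  ssrbool.symmetric e -> irreflexive e ->
  let z j := x (path_vertex a0 k j) in
  (forall v, v != a0 -> y v = f (x (inl v))) ->
  f (C_ k z k) * y a0 = f (B_ k z k) ->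
  f (indep_poly (add_path e a0 k) x) = f (C_ k z k) * indep_poly e y.
Proof.
move=> e_sym e_irr z yE ya0; rewrite indep_poly_add_path // -/z.
rewrite rmorphD !rmorphM !rmorph_indep_poly_in -ya0 indep_poly_inT.
rewrite (indep_poly_in_del e_sym e_irr y (in_setT a0)) mulrDr mulrA setTD.
by congr (_ * _ + _ * _); apply: eq_indep_poly_in => v; rewrite !inE => h;
  rewrite yE //; case/andP: h.
Qed.

(** * The recurrence: naturality, special labels and closed form *)

Lemma rmorph_BC (R S : comNzRingType) (f : {rmorphism R -> S}) k z i :
  BC k (f \o z) i = (f (BC k z i).1, f (BC k z i).2).
Proof.
elim: i => [|i IHi] /=; first by rewrite rmorph1.
by rewrite IHi; case: BC => b c /=; rewrite !rmorphD !rmorphM rmorph0 rmorph1.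
Qed.

Lemma eq_BC (R : comNzRingType) k (z z' : nat -> R) i :
  (forall j, (j <= k)%N -> z j = z' j) -> BC k z i = BC k z' i.
Proof.
move=> zz'; elim: i => [|i IHi] /=; first by rewrite zz'.
by rewrite IHi zz' // -subnDA leq_subr.
Qed.

Lemma BC_zero (R : comNzRingType) k i : BC k (fun=> 0 : R) i = (0, 1).
Proof. by elim: i => //= i ->; rewrite !mul0r mul1r mulr1 !add0r. Qed.

(** For constant labels [t] the recurrence matrix has characteristic polynomial
    $\lambda^2-\lambda-t$, whose roots are [lam1] and [lam2]. *)
Lemma BC_const (F : fieldType) (t lam1 lam2 : F) k i :
  lam1 + lam2 = 1 -> lam1 * lam2 = - t -> lam1 != lam2 ->
  BC k (fun=> t) i =
    (t / (lam2 - lam1) * (lam2 ^+ (i + 1) - lam1 ^+ (i + 1)),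
     1 / (lam2 - lam1) * (lam2 ^+ (i + 2) - lam1 ^+ (i + 2))).
Proof.
move=> sum_lam prod_lam neq_lam.
have d_neq0 : lam2 - lam1 != 0 by rewrite subr_eq0 eq_sym.
have -> : t = - (lam1 * lam2) by rewrite prod_lam opprK.
have lam2E : lam2 = 1 - lam1 by rewrite -sum_lam addrC addKr.
elim: i => [|i /= ->].
  congr pair; rewrite /= ?add0n ?expr1; first by field.
  by rewrite subr_sqr (addrC lam2 lam1) sum_lam mulr1; field.
congr pair; rewrite !addn1 !addn2 !exprS; first by field.
(* With the powers made opaque and [lam2] eliminated, a rational identity in [lam1], [p] and [q]
   remains. *)
move: d_neq0; move: (lam1 ^+ i) (lam2 ^+ i) => p q; rewrite lam2E => d_neq0.
by field.
Qed.

Theorem theorem3p10 (T : finType) (e : rel T)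
    (e_sym : ssrbool.symmetric e) (e_irr : irreflexive e)
    (a0 : T) (k : nat) (k_gt0 : (0 < k)%N)
    (n : nat) (l : T + 'I_k -> 'I_n) :
  (forall D : idomainType,
     let x (w : T + 'I_k) : {mpoly D[n]} := 'X_(l w) in
     let B : {mpoly D[n]} := B_ k (fun j => x (path_vertex a0 k j)) k in
     let C : {mpoly D[n]} := C_ k (fun j => x (path_vertex a0 k j)) k in
     let y : T -> {fraction {mpoly D[n]}} :=
       fun v => if v == a0 then tofrac B / tofrac C else tofrac (x (inl v)) in
     C != 0 /\
     tofrac (indep_poly (add_path e a0 k) x) = tofrac C * indep_poly e y)
  /\
  (forall (R : realType) (t : R), - (1 / 4) < t -> t != 0 ->
     let lam1 : R := 1 / 2 + Num.sqrt (1 / 4 + t) in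
     let lam2 : R := 1 / 2 - Num.sqrt (1 / 4 + t) in
     lam1 ^+ (k + 2) <> lam2 ^+ (k + 2) ->
     let x (w : T + 'I_k) : {mpoly R[n]} :=
       if on_path a0 w then t%:MP else 'X_(l w) in
     let B : R :=
       t / (lam2 - lam1) * (lam2 ^+ (k + 1) - lam1 ^+ (k + 1)) in
     let C : R :=
       1 / (lam2 - lam1) * (lam2 ^+ (k + 2) - lam1 ^+ (k + 2)) in
     let y : T -> {mpoly R[n]} :=
       fun v => if v == a0 then (B / C)%:MP else x (inl v) in
     [/\ C != 0,
         B_ k (fun j => x (path_vertex a0 k j)) k = B%:MP,
         C_ k (fun j => x (path_vertex a0 k j)) k = C%:MP
       & indep_poly (add_path e a0 k) x = C%:MP * indep_poly e y]).

Proof.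
split=> [D x B C y | R t t_gt t_neq0 lam1 lam2 neq_pow x B C y].
  have C_neq0 : C != 0.
    (* Evaluating every variable at 0 sends $C_k$ to 1, so $C_k$ is a nonzero polynomial. *)
    pose ev : {rmorphism {mpoly D[n]} -> D} := mmap idfun (fun=> 0).
    apply/eqP => /(congr1 ev); rewrite rmorph0 /C /C_.
    have := rmorph_BC ev k (fun j => x (path_vertex a0 k j)) k.
    rewrite (@eq_BC _ k _ (fun=> 0)) => [|j _]; last first.
      by rewrite /ev /= mmapX mmap1U.
    by rewrite BC_zero => -[_ C1] C0; have /eqP := etrans C1 C0; rewrite oner_eq0.
  split=> //; apply: indep_poly_add_path_div => // [v /negbTE va0|].
    by rewrite /y va0.
  by rewrite /y eqxx mulrC divfK // tofrac_eq0.
(* The bound on [t] makes the square root positive, hence the two roots real and distinct. *)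
have disc_gt0 : 0 < 1 / 4 + t by lra.
have sqrt_gt0 : 0 < Num.sqrt (1 / 4 + t) by rewrite sqrtr_gt0.
have sum_lam : lam1 + lam2 = 1 by rewrite /lam1 /lam2; field.
have prod_lam : lam1 * lam2 = - t.
  by rewrite [LHS]mulrC -subr_sqr sqr_sqrtr ?ltW //; field.
have lt_lam : lam2 < lam1 by rewrite /lam1 /lam2; lra.
have neq_lam : lam1 != lam2 by rewrite gt_eqF.
have C_neq0 : C != 0.
  rewrite /C mulf_neq0 ?mul1r ?invr_eq0 // subr_eq0 1?eq_sym //; exact/eqP.
have x_path j : (j <= k)%N -> x (path_vertex a0 k j) = t%:MP.
  move=> le_jk; rewrite /x ifT //; apply/existsP.
  by exists (Ordinal (le_jk : (j < k.+1)%N)).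
have BC_k : BC k (fun j => x (path_vertex a0 k j)) k = (B%:MP, C%:MP).
  (* All labels read by the recurrence are the constant [t], so the closed form over [R] is carried
     over by [mpolyC]. *)
  rewrite (@eq_BC _ k _ (@mpolyC n R \o fun=> t)) //.
  by rewrite rmorph_BC (BC_const k k sum_lam prod_lam neq_lam).
split=> //; rewrite ?/B_ ?/C_ ?BC_k //.
(* Here [B / C] is a scalar, so the identity morphism suffices in place of [tofrac]. *)
have := @indep_poly_add_path_div T e a0 k _ _ idfun x y e_sym e_irr.
rewrite /= /B_ /C_ BC_k /=; apply=> [v /negbTE va0|]; rewrite /y ?va0 ?eqxx //.
by rewrite -mpolyCM mulrC divfK.
Qed.
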